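(* Let $\gamma$ be a composition of $n$. The map $\mathfrak c_\gamma$ is a crystal isomorphism $$B(1)\otimes\cdots\otimes B(1)\;(n\text{ factors})\;\cong\;\mathcal B^\dagger(\gamma),$$ that is, a weight-preserving bijection with $\mathfrak c_\gamma(\tilde e_i(b))=e_i^\dagger(\mathfrak c_\gamma(b))$ for all $b$ and all $i$ (with $\mathfrak c_\gamma(0)=0$). Moreover, for each partition $\mu$ of $n$, the set of highest weight elements of $\mathcal B^\dagger(\gamma)$ of weight $\mu$ is $$\{T\in\mathcal{CT}(\mu,\gamma): \text{the entries of } T \text{ strictly increase up columns in prismatic order}\}.$$
   Context: Compositions are finite sequences of non-negative integers, up to trailing zeros. The shape of $\gamma$ is the set of cells $(r,c)$, $1\le c\le\gamma_r$, rows counted upward from the bottom, columns from left to right. Reading order of cells: from the highest row down to the lowest, left to right within each row. Words. $B(1)^n=B(1)\otimes\cdots\otimes B(1)$ is the set of words $b$ of length $n$ in the alphabet $[n]=\{1,\dots,n\}$, with $\mathrm{wt}(b)=\prod_j x_{b_j}$. For $1\le i\le n-1$: in the subword of letters $i,i+1$ regard each $i+1$ as ''('' and each $i$ as '')'' and match parentheses as usual; the unmatched letters form $i^p(i+1)^q$. $\tilde e_i(b)=0$ if $q=0$, otherwise $\tilde e_i(b)$ replaces the unmatched subword by $i^{p+1}(i+1)^{q-1}$; $\tilde f_i(b)=0$ if $p=0$, otherwise $\tilde f_i(b)$ replaces it by $i^{p-1}(i+1)^{q+1}$. Colored tabloids. Colored letters $x_y$ are positive integers $x$ with positive integer subscripts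 $y$. Prismatic order: $u_v>r_c$ iff $r<u$, or $r=u$ and $c>v$. $\mathcal{CT}(\delta,\gamma)$ is the set of fillings of the shape $\delta$ by the colored letters $x_y$, $1\le y\le\gamma_x$, each used once, with rows increasing from left to right in prismatic order; $\mathcal{CT}(\cdot,\gamma)$ is the union over all compositions $\delta=(\delta_1,\dots,\delta_n)$ of $n$ (zero parts allowed). The map $\mathfrak c_\gamma$. For $b\in B(1)^n$ let $f_b$ be the filling of shape $\gamma$ whose entries, listed in reading order, form $b$. $\mathfrak c_\gamma(b)$ is the colored tabloid obtained by placing, for each cell $(r,c)$ of $\gamma$ with entry $e$ in $f_b$, the colored letter $r_c$ in row $e$, each row being then sorted increasingly. The graph $\mathcal B^\dagger(\gamma)$. Its vertex set is $\mathcal{CT}(\cdot,\gamma)$, with $\mathrm{wt}(T)=x^{\mathrm{shape}(T)}$. For $1\le i\le n-1$, the $i$-inflation of $T$ respaces row $i$ as follows: the entries $e$ of row $i$ are taken from left to right, and each is placed in the leftmost empty cell of row $i$ that does not have an entry $e'<e$ of row $i+1$ directly above it (row $i+1$ is left-justified and unchanged). $e_i^\dagger(T)$ is obtained by taking the largest entry of row $i+1$ lying immediately above an empty cell in the $i$-inflation, moving it down into that empty cell, and then removing all empty cells (left-justifying rows); $e_i^\dagger(T)=0$ if no entry of row $i+1$ lies above an empty cell. There is an $i$-colored edge $T\to T'$ when $e_i^\dagger(T)=T'$. A highest weight element is a vertex annihilated by $e_i^\dagger$ for all $i$; it has weight $\mu$ when its wt is $x^\mu$. *)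

(* Defs.v *)
From HB Require Import structures.
From mathcomp Require Import all_boot all_order all_algebra.
From mathcomp Require Import mpoly.

Set Implicit Arguments.
Unset Strict Implicit.
Unset Printing Implicit Defensive.

Import GRing.Theory.
Local Open Scope ring_scope.

(* All indices are 0-based: the k-th part of a composition
   [gamma : seq nat] is [nth 0 gamma k] (so trailing zeros are irrelevant), the
   letters 1, ..., n are the elements of 'I_n, rows and columns are numbered
   from 0, and the colored letter x_y is the pair (x.-1, y.-1). An index
   1 <= i <= n - 1 of a crystal operator is a pair (i, j) of letters with
   j = i.+1. The element 0 of a crystal is [None]. *)

Definition word (n : nat) := n.-tuple 'I_n.

Definition wt_word (n : nat) (b : word n) : {mpoly int[n]} :=
  \prod_(k < n) 'X_(tnth b k).

(* Bracketing of [w], with [hi] as "(" and [lo] as ")"; [k] is the position of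
   the head of [w], [opens] is the stack of pending "(" and [closes] lists the
   unmatched ")", both most recent first. The result is the pair of increasing
   lists of positions of the unmatched [lo] and of the unmatched [hi]; the
   former all precede the latter. *)
Fixpoint bracket (A : eqType) (lo hi : A) (k : nat) (opens closes : seq nat)
    (w : seq A) : seq nat * seq nat :=
  match w with
  | [::] => (rev closes, rev opens)
  | a :: w' =>
    if a == hi then bracket lo hi k.+1 (k :: opens) closes w'
    else if a == lo then
      if opens is _ :: opens' then bracket lo hi k.+1 opens' closes w'
      else bracket lo hi k.+1 opens (k :: closes) w'
    else bracket lo hi k.+1 opens closes w'
  end.

Definition unmatched (A : eqType) (lo hi : A) (w : seq A) : seq nat * seq nat :=
  bracket lo hi 0 [::] [::] w.

Definition e_tilde (n : nat) (i j : 'I_n) (b : word n) : option (word n) :=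
  let: (lows, highs) := unmatched i j b in
  let pos := lows ++ highs in
  let p := size lows in
  if size highs is q'.+1 then
    let new := nseq p.+1 i ++ nseq q' j in
    Some [tuple if (k : nat) \in pos then nth i new (index (k : nat) pos)
                else tnth b k | k < n]
  else None.

Definition cletter := (nat * nat)%type.

Definition prism_lt (a b : cletter) : bool :=
  ((a.1 < b.1) || ((a.1 == b.1) && (b.2 < a.2)))%N.

Definition prism_le (a b : cletter) : bool := (a == b) || prism_lt a b.

(* The cells of the shape of [gamma], in reading order. These pairs are also
   the colored letters used by the fillings in CT(delta, gamma). *)
Definition reading_cells (gamma : seq nat) : seq (nat * nat) :=
  [seq (r, c) | r <- rev (iota 0 (size gamma)), c <- iota 0 (nth 0%N gamma r)].

(* Row r of a filling, read from left to right, is its r-th component. *)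
Definition filling (n : nat) := n.-tuple (seq cletter).

Definition fshape (n : nat) (T : filling n) : n.-tuple nat := map_tuple size T.

Definition CT (n : nat) (delta : n.-tuple nat) (gamma : seq nat)
    (T : filling n) : Prop :=
  [/\ fshape T = delta,
      perm_eq (flatten T) (reading_cells gamma)
    & forall r : 'I_n, sorted prism_lt (tnth T r)].

Definition CTany (n : nat) (gamma : seq nat) (T : filling n) : Prop :=
  exists delta : n.-tuple nat, sumn delta = n /\ CT delta gamma T.

Definition xpow (n : nat) (d : n.-tuple nat) : {mpoly int[n]} :=
  'X_[[multinom d]].

Definition wt_CT (n : nat) (T : filling n) : {mpoly int[n]} := xpow (fshape T).

(* The filling f_b, as the list of its (cell, entry) pairs in reading order. *)
Definition word_filling (gamma : seq nat) (n : nat) (b : word n) :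
    seq ((nat * nat) * 'I_n) :=
  zip (reading_cells gamma) b.

Definition c_map (gamma : seq nat) (n : nat) (b : word n) : filling n :=
  [tuple sort prism_le
           [seq ce.1 | ce <- word_filling gamma b & ce.2 == e] | e < n].

(* Rows with empty cells: [None] is an empty cell, and so is every cell beyond
   the end of the list. *)
Definition spaced_row := seq (option cletter).

Definition place (up : seq cletter) (row : spaced_row) (e : cletter) :
    spaced_row :=
  let allowed c :=
    (nth None row c == None)
    && ~~ (if onth up c is Some e' then prism_lt e' e else false) in
  (* the column [maxn (size row) (size up)] is always allowed *)
  let c := find allowed (iota 0 (maxn (size row) (size up)).+1) in
  set_nth None row c (Some e).

Definition inflation (up low : seq cletter) : spaced_row :=
  foldl (place up) [::] low.

Definition squeeze (row : spaced_row) : seq cletter := pmap id row.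

Definition movable (up low : seq cletter) : seq nat :=
  [seq c <- iota 0 (size up) | nth None (inflation up low) c == None].

Definition largest_movable (up low : seq cletter) : option nat :=
  let entry c := nth (0%N, 0%N) up c in
  ohead [seq c <- movable up low |
          all (fun c' => prism_le (entry c') (entry c)) (movable up low)].

Definition e_dagger (n : nat) (i j : 'I_n) (T : filling n) :
    option (filling n) :=
  let low := tnth T i in
  let up := tnth T j in
  if largest_movable up low is Some c then
    let low' := squeeze (set_nth None (inflation up low) c (onth up c)) in
    let up' := squeeze (set_nth None (map Some up) c None) in
    Some [tuple if k == i then low' else if k == j then up' else tnth T k
         | k < n]
  else None.

Definition highest_weight (n : nat) (T : filling n) : Prop :=
  forall i j : 'I_n, j = i.+1 :> nat -> e_dagger i j T = None.

Definition column_strict (n : nat) (T : filling n) : Prop :=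
  forall (r r' : 'I_n) (c : nat) (x y : cletter), (r < r')%N ->
    onth (tnth T r) c = Some x -> onth (tnth T r') c = Some y -> prism_lt x y.

(* Main.v *)
(** The reading order of the cells of [gamma] is the decreasing prismatic order.
    Hence row [e] of [c_map gamma b] lists, from right to left, the positions of
    the letter [e] in [b]: an unmatched "(" of the word should correspond to an
    entry of row [i+1] above an empty cell of the [i]-inflation. The inflation
    need not match the same parentheses as the usual bracketing, but the position
    acted upon by [e_tilde], the leftmost unmatched "(", is characterised by
    inequalities between the numbers of "(" and ")" in factors of the word.
    In the inflation each cell pairs an entry [e] with a larger one above it, and
    each empty cell separates the entries smaller and larger than the entry above
    it; counting these pairs gives the same inequalities for the largest movable
    entry. On a filling of partition shape, the inflation fills all the cells
    below row [i+1] exactly when rows [i] and [i+1] form strict columns. *)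

Require Import Defs.
From mathcomp Require Import all_boot all_order all_algebra.
From mathcomp Require Import mpoly.
From mathcomp Require Import zify.

Set Implicit Arguments.
Unset Strict Implicit.
Unset Printing Implicit Defensive.

(** * Prismatic order and rows of [c_map] *)

Lemma prism_lt_irr : irreflexive prism_lt.
Proof. by move=> [a b]; rewrite /prism_lt /= !ltnn andbF. Qed.

Lemma prism_lt_trans : transitive prism_lt.
Proof. by move=> [a b] [c d] [e f]; rewrite /prism_lt /=; lia. Qed.

Lemma prism_lt_asym x y : prism_lt x y -> ~~ prism_lt y x.
Proof.
by move=> xy; apply/negP => /(prism_lt_trans xy); rewrite prism_lt_irr.
Qed.

Lemma prism_lt_total x y : x != y -> ~~ prism_lt x y -> prism_lt y x.
Proof.
case: x y => [a b] [c d]; rewrite /prism_lt /= xpair_eqE; lia.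
Qed.

Lemma sorted_nth_prism (x0 : cletter) s i j :
  sorted prism_lt s -> (i < j < size s)%N ->
  prism_lt (nth x0 s i) (nth x0 s j).
Proof.
move=> sS /andP[ij js]; apply: (sorted_ltn_nth prism_lt_trans) => //.
by rewrite inE (ltn_trans ij js).
Qed.

Lemma reading_cells_sorted gamma :
  sorted (fun x y => prism_lt y x) (reading_cells gamma).
Proof.
apply: pairwise_sorted; rewrite /reading_cells.
have : pairwise gtn (rev (iota 0 (size gamma))).
  rewrite -sorted_pairwise; last by move=> x y z /=; lia.
  by rewrite rev_sorted; apply: iota_ltn_sorted.
elim: (rev _) => [//|r s IH] /= /andP[/allP rs /IH{}IH].
rewrite pairwise_cat IH andbT; apply/andP; split.
  apply/allrelP => x y /mapP[c _ ->] /allpairsPdep[r' [c' [r's _ ->]]].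
  by have /= rr' := rs _ r's; rewrite /prism_lt /= rr'.
rewrite pairwise_map -sorted_pairwise.
  apply: (@sub_sorted _ ltn); last exact: iota_ltn_sorted.
  by move=> x y /= xy; rewrite /prism_lt /= eqxx xy orbT.
by move=> x y z; rewrite /= /prism_lt /=; lia.
Qed.

Lemma reading_cells_uniq gamma : uniq (reading_cells gamma).
Proof.
apply: (sorted_uniq _ _ (reading_cells_sorted gamma)).
  by move=> x y z /= xy yz; apply: prism_lt_trans yz xy.
by move=> x; apply: prism_lt_irr.
Qed.

Lemma size_reading_cells gamma : size (reading_cells gamma) = sumn gamma.
Proof.
rewrite /reading_cells size_allpairs_dep map_rev sumn_rev.
rewrite -[in RHS](mkseq_nth 0%N gamma); congr sumn.
by apply: eq_map => r; rewrite size_iota.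
Qed.

(** Turns comparisons of colored letters into reversed comparisons of positions in the word, which
    [lia] can settle. *)
Lemma prism_lt_index gamma x y :
    x \in reading_cells gamma -> y \in reading_cells gamma ->
  prism_lt x y =
    (index y (reading_cells gamma) < index x (reading_cells gamma))%N.
Proof.
set s := reading_cells gamma => xs ys.
have H u v : u \in s -> v \in s -> (index u s < index v s)%N -> prism_lt v u.
  move=> us vs uv; rewrite -(nth_index (0, 0)%N us) -(nth_index (0, 0)%N vs).
  apply: (sorted_ltn_nth (leT := fun x y => prism_lt y x)) => //.
  - by move=> a b c /= ab bc; apply: prism_lt_trans bc ab.
  - exact: reading_cells_sorted.
  - by rewrite inE index_mem.
  - by rewrite inE index_mem.
apply/idP/idP; last exact: H.
move=> xy; case: ltngtP => // [/(H _ _ xs ys)|/(index_inj x ys xs) E].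
  by rewrite (negbTE (prism_lt_asym xy)).
by move: xy; rewrite E prism_lt_irr.
Qed.

Lemma perm_c_map gamma n (b : word n) e :
  perm_eq (tnth (c_map gamma b) e)
    [seq ce.1 | ce <- word_filling gamma b & ce.2 == e].
Proof. by rewrite tnth_mktuple perm_sort. Qed.

Lemma mem_c_map gamma n (b : word n) e x : sumn gamma = n ->
  (x \in tnth (c_map gamma b) e) =
    (onth b (index x (reading_cells gamma)) == Some e).
Proof.
move=> gn; rewrite (perm_mem (perm_c_map gamma b e)).
have sz : size (reading_cells gamma) = size b.
  by rewrite size_reading_cells size_tuple gn.
have U := reading_cells_uniq gamma.
rewrite /word_filling; apply/mapP/eqP => [[[y a]]|].
  rewrite mem_filter /= => /andP[/eqP-> yz] -> {x a}.
  have /(nthP (y, e))[k] := yz; rewrite size_zip sz minnn => kb.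
  rewrite nth_zip // => -[ky kE].
  by rewrite -ky index_uniq ?sz // (onthE, onthTE) (nth_map e) // kE.
set k := index _ _ => kE.
have kb : (k < size b)%N by rewrite -onthTE kE.
have kx : nth x (reading_cells gamma) k = x.
  by rewrite nth_index // -index_mem sz.
exists (x, e) => //; rewrite mem_filter eqxx /=.
have -> : (x, e) = nth (x, e) (zip (reading_cells gamma) b) k.
  rewrite nth_zip // kx; congr (_, _).
  by move: kE; rewrite onthE (nth_map e) // => -[].
by rewrite mem_nth // size_zip sz minnn.
Qed.

Lemma c_map_sorted gamma n (b : word n) e : sumn gamma = n ->
  sorted prism_lt (tnth (c_map gamma b) e).
Proof.
move=> gn; set s := tnth _ _.
have U : uniq s.
  rewrite (perm_uniq (perm_c_map gamma b e)).
  have : uniq (unzip1 (word_filling gamma b)).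
    rewrite /word_filling unzip1_zip ?reading_cells_uniq //.
    by rewrite size_reading_cells size_tuple gn.
  by apply: subseq_uniq; apply: map_subseq; apply: filter_subseq.
have : sorted prism_le s.
  rewrite /s tnth_mktuple; apply: sort_sorted => x y; rewrite /prism_le.
  case: eqVneq => //= xy; have [//|/(prism_lt_total xy)->] := boolP (prism_lt x y).
  by rewrite orbT.
case: s U => //= x s; elim: s x => //= y s IH x.
rewrite inE negb_or => /andP[/andP[xy xs] U] /andP[xLy ys].
rewrite IH // andbT; by move: xLy; rewrite /prism_le (negbTE xy).
Qed.

Lemma prism_sorted_eq s t :
  sorted prism_lt s -> sorted prism_lt t -> s =i t -> s = t.
Proof. exact: irr_sorted_eq prism_lt_trans prism_lt_irr _ _. Qed.

(** * The leftmost unmatched parenthesis *)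

(* [H d] and [L d] count the "(" and the ")" among the first [d] of [N]
   letters. The letter [m] is the leftmost unmatched "(" when every factor
   ending just before [m] has at least as many ")" as "(", and every factor
   starting at [m] has more "(" than ")". *)
Definition none_unmatched (H L : nat -> nat) N :=
  forall d, (d <= N)%N -> (H N + L d <= L N + H d)%N.

Definition first_unmatched (H L : nat -> nat) N m :=
  [/\ (m < N)%N,
      forall d, (d <= m)%N -> (H m + L d <= L m + H d)%N
    & forall d, (m < d <= N)%N -> (L d + H m < H d + L m)%N].

(** For [m < m'], the factor from [m] to [m'] would have a surplus of opening parentheses by the
    third clause for [m], and none by the second clause for [m']. This identifies the position found
    in the word with the one found in the inflation. *)
Lemma first_unmatched_uniq H L N m m' :
  first_unmatched H L N m -> first_unmatched H L N m' -> m = m'.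
Proof.
case=> mN mle mgt [m'N m'le m'gt].
case: (ltngtP m m') => // lt_mm'.
  by have := mgt m'; have := m'le m; lia.
by have := m'gt m; have := mle m'; lia.
Qed.

Lemma none_first_unmatched H L N m :
  none_unmatched H L N -> ~ first_unmatched H L N m.
Proof. by move=> none [mN _ mgt]; have := none m; have := mgt N; lia. Qed.

(** Induction along [bracket]. Pops occur at the recent end of the stack, so its oldest entry stays
    the leftmost unmatched parenthesis until the stack empties. *)
Lemma unmatchedP (A : eqType) (lo hi : A) (w : seq A) : lo != hi ->
  let H d := count_mem hi (take d w) in
  let L d := count_mem lo (take d w) in
  let: (lows, highs) := unmatched lo hi w in
  [/\ {in lows, forall k, onth w k = Some lo},
      {in highs, forall k, onth w k = Some hi}
    & if highs is m :: _ then first_unmatched H L (size w) m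
      else none_unmatched H L (size w)].
Proof.
move=> lohi H L; rewrite /unmatched.
(* Here [os] runs from the oldest pending parenthesis [m] to the newest. The equation says that the
   surplus of [hi] over [lo] from [m] on is the height of the stack. *)
pose Inv k os := if os is m :: _ then
  first_unmatched H L k m /\ (H k + L m = L k + H m + size os)%N
  else none_unmatched H L k.
have main v k os cs : (k <= size w)%N -> drop k w = v ->
    {in cs, forall k, onth w k = Some lo} ->
    {in os, forall k, onth w k = Some hi} -> Inv k (rev os) ->
    let: (lows, highs) := bracket lo hi k os cs v in
    [/\ {in lows, forall k, onth w k = Some lo},
      {in highs, forall k, onth w k = Some hi}
    & if highs is m :: _ then first_unmatched H L (size w) m
      else none_unmatched H L (size w)].
  elim: v k os cs => [|a v IH] k os cs kw wE csP osP inv /=.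
    split=> [x|x|]; rewrite ?mem_rev; [exact: csP | exact: osP |].
    have kE : k = size w.
      by apply/eqP; rewrite eqn_leq kw /= -subn_eq0 -size_drop wE.
    by move: inv; rewrite kE /Inv; case: (rev os) => [|m t] // [].
  have kw' : (k < size w)%N.
    by rewrite -subn_gt0 -size_drop wE.
  have wa : onth w k = Some a.
    by rewrite -[w](cat_take_drop k) onth_cat size_take kw' ltnn subnn wE.
  have wv : drop k.+1 w = v by rewrite -add1n -drop_drop wE /= drop0.
  have tk : take k.+1 w = rcons (take k w) a.
    by rewrite (take_nth a) // (onth_nth _ _ _ _ wa).
  have HS : H k.+1 = (H k + (a == hi))%N.
    by rewrite /H tk -cats1 count_cat /= addn0.
  have LS : L k.+1 = (L k + (a == lo))%N.
    by rewrite /L tk -cats1 count_cat /= addn0.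
  clearbody H L; have LEk d : (d <= k.+1)%N -> d = k.+1 \/ (d <= k)%N by lia.
  move: inv HS LS.
  have [ahi|nahi] := eqVneq a hi.
    rewrite eq_sym ahi (negbTE lohi) => inv HS LS; apply: IH => //.
      by move=> x; rewrite inE => /predU1P[->|/osP//]; rewrite -ahi.
    rewrite rev_cons; move: inv; case: (rev os) => [|m t] /= inv.
      split; last by rewrite HS LS; lia.
      split=> // d ?.
      by have -> : d = k.+1; [lia | rewrite HS LS; lia].
    case: inv => -[mk mle mgt] tot.
    split; last by rewrite HS LS size_rcons; lia.
    split=> // [|d /andP[md /LEk[->|dk]]]; first lia.
      by rewrite HS LS; lia.
    by apply: mgt; rewrite md.
  have [alo|nalo] := eqVneq a lo => inv HS LS; last first.
    apply: IH => //; move: inv; case: (rev os) => [|m t] /= inv.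
      by move=> d /LEk[->|/inv]; lia.
    case: inv => -[mk mle mgt] tot.
    split; last lia.
    split=> // [|d /andP[md /LEk[->|dk]]]; [lia|lia|].
    by apply: mgt; rewrite md.
  case: os inv osP => [|x os] inv osP.
    apply: IH => //.
      by move=> x; rewrite inE => /predU1P[->|/csP//]; rewrite -alo.
    by move=> d /LEk[->|/inv]; lia.
  apply: IH => //; first by move=> y yos; apply: osP; rewrite inE yos orbT.
  move: inv; rewrite rev_cons; case: (rev os) => [|m t] /= [[]].
    (* The oldest entry [x] is popped, so the factor from [x] on is now balanced: a factor starting
       before [x] inherits its bound from [x], and one starting after [x] has lost a surplus of
       [hi]. *)
    move=> mk mle mgt tot d /LEk[->|dk]; first by rewrite addnC.
    case: (leqP d x) => [/mle|md]; first lia.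
    by have := mgt d; lia.
  move=> mk mle mgt; rewrite size_rcons => tot.
  split; last lia.
  split=> // [|d /andP[md /LEk[->|dk]]]; [lia|lia|].
  by apply: mgt; rewrite md.
apply: main; rewrite ?drop0 // => d; rewrite leqn0 => /eqP->.
by rewrite /H /L take0.
Qed.

(** Although [e_tilde] rewrites the whole unmatched subword, the old and new subwords differ only at
    index [size lows], which is the head of [highs]. *)
Lemma e_tildeP n (i j : 'I_n) (b : word n) : i != j ->
  let H d := count_mem j (take d b) in
  let L d := count_mem i (take d b) in
  if e_tilde i j b is Some b' then
    exists m : 'I_n, [/\ first_unmatched H L n m, tnth b m = j
      & forall k, tnth b' k = if k == m then i else tnth b k]
  else none_unmatched H L n.
Proof.
move=> ij H L; rewrite /e_tilde.
have := unmatchedP b ij; case: (unmatched i j b) => lows highs.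
rewrite size_tuple => -[lowP highP].
case: highs highP => [|m t] //= highP first.
have [mn _ _] := first; exists (Ordinal mn).
have tnthE (k : 'I_n) a : onth b k = Some a -> tnth b k = a.
  by move=> ka; rewrite (tnth_nth a) (onth_nth _ _ _ _ ka).
have bm : tnth b (Ordinal mn) = j.
  by apply/tnthE/highP; rewrite inE eqxx.
split=> // k; rewrite tnth_mktuple.
(* Past the end of the list [nth] returns its default [i], hence the upper bound. *)
have newE x : nth i (i :: nseq (size lows) i ++ nseq (size t) j) x =
    if (size lows < x <= size lows + size t)%N then j else i.
  rewrite -cat_cons -[i :: nseq _ _]/(nseq (size lows).+1 i) nth_cat.
  by rewrite size_nseq !nth_nseq if_same ltnS; do 3?case: ifP => //; lia.
rewrite -val_eqE /= newE mem_cat inE index_cat.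
have [klow|klow] /= := boolP (val k \in lows).
  rewrite ltnNge ltnW ?index_mem //= (tnthE _ _ (lowP _ klow)).
  by rewrite if_same.
have [-> |km] := eqVneq (val k) m.
  by rewrite addn0 ltnn.
case: ifP => //= kt.
rewrite leq_add2l index_mem kt addnS ltnS leq_addr.
by apply/esym/tnthE/highP; rewrite inE kt orbT.
Qed.

(** * Inflations *)

(* Left to right placement never goes back: the last condition forces each new
   entry beyond the cells used so far, so that the row stays increasing. *)
Definition inflated (up low : seq cletter) (row : spaced_row) :=
  [/\ squeeze row = low,
      forall c e u, nth None row c = Some e -> onth up c = Some u ->
        prism_lt e u
    & forall c c' e, (c < c')%N -> nth None row c = None ->
        nth None row c' = Some e ->
        exists2 u, onth up c = Some u & prism_lt u e].

Lemma placeE up row e : exists c,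
  [/\ place up row e = set_nth None row c (Some e),
      nth None row c = None,
      forall u, onth up c = Some u -> ~~ prism_lt u e
    & forall c', (c' < c)%N -> nth None row c' = None ->
        exists2 u, onth up c' = Some u & prism_lt u e].
Proof.
pose allowed c := (nth None row c == None)
  && ~~ (if onth up c is Some e' then prism_lt e' e else false).
pose s := iota 0 (maxn (size row) (size up)).+1.
pose c := find allowed s; exists c.
have has_s : has allowed s.
  apply/hasP; exists (maxn (size row) (size up)).
    by rewrite mem_iota /=.
  by rewrite /allowed nth_default ?leq_maxl // onth_default ?leq_maxr.
have cs : (c < (maxn (size row) (size up)).+1)%N.
  by move: has_s; rewrite has_find size_iota.
have : allowed c by have := nth_find 0%N has_s; rewrite nth_iota.
case/andP => /eqP c_empty c_ok; split=> // [u cu|c' c'c c'_empty].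
  by move: c_ok; rewrite cu.
have := before_find 0%N c'c; rewrite nth_iota ?(ltn_trans c'c) // add0n.
rewrite /allowed c'_empty eqxx /=.
by case: (onth up c') => // u /negbFE; exists u.
Qed.

(** Induction from the right end of [low]. As the rows are disjoint, totality turns the failure of
    [prism_lt u e] in [place] into [prism_lt e u]. *)
Lemma inflationP up low : sorted prism_lt low ->
  {in low, forall x, x \notin up} -> inflated up low (inflation up low).
Proof.
move=> lowS low_up.
(* The added clause says that the row never ends in an empty cell. *)
suff [] : inflated up low (inflation up low) /\
    (forall x, exists y, last (Some x) (inflation up low) = Some y) by [].
rewrite /inflation; elim/last_ind: low lowS low_up => [|low e IH] lowS low_up.
  split; last by move=> x; exists x.
  by split=> [|c e u|c c' e] //=; rewrite ?nth_nil.
have [] := IH.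
- by move: lowS; rewrite -cats1 => /cat_sorted2[].
- by move=> x xlow; apply: low_up; rewrite mem_rcons inE xlow orbT.
rewrite foldl_rcons; set row := foldl _ _ _ => -[rowE below after] lastP.
have [c [-> c_empty c_ok c_min]] := placeE up row e.
have low_e x : x \in low -> prism_lt x e.
  move=> xlow; move: lowS; rewrite (sorted_pairwise prism_lt_trans).
  by rewrite pairwise_rcons => /andP[/allP/(_ _ xlow)].
have mem_low c' x : nth None row c' = Some x -> x \in low.
  move=> c'x; rewrite -rowE /squeeze mem_pmap map_id -c'x mem_nth //.
  by rewrite ltnNge; apply/negP => /(nth_default None); rewrite c'x.
(* An empty cell left of the last entry [y] has some [u < y < e] above it, which forbids [e] there;
   so [e] goes past the end of the row. *)
have row_c : (size row <= c)%N.
  rewrite leqNgt; apply/negP => c_row.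
  have [y yE] := lastP e.
  have y_last : nth None row (size row).-1 = Some y.
    by rewrite nth_last -yE; case: (row) c_row.
  have cl : (c < (size row).-1)%N.
    rewrite ltn_neqAle; apply/andP; split; last by case: (size row) c_row.
    by apply/eqP => cE; move: c_empty; rewrite cE y_last.
  have [u cu uy] := after _ _ _ cl c_empty y_last.
  have := c_ok _ cu; rewrite (prism_lt_trans uy) //.
  exact/low_e/(mem_low _ _ y_last).
have setE : set_nth None row c (Some e) =
    row ++ rcons (nseq (c - size row) None) (Some e).
  by rewrite set_nthE ltnNge row_c /= -cats1 cat_nseq.
have nthE c' : nth None (set_nth None row c (Some e)) c' =
    if c' == c then Some e else nth None row c'.
  by rewrite nth_set_nth.
split; last by move=> x; exists e; rewrite setE last_cat last_rcons.
split=> [|c' x u|c' c'' x c'c''].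
- rewrite setE /squeeze pmap_cat -cats1 pmap_cat [pmap id row]rowE /=.
  by rewrite -cats1; congr cat; elim: (c - size row) => //= k ->.
- rewrite nthE; case: eqVneq => [->|_]; last exact: below.
  move=> [<-] cu; apply: prism_lt_total (c_ok _ cu).
  have : e \notin up by apply: low_up; rewrite mem_rcons mem_head.
  apply: contraNneq => <-; apply/onthP; by exists c.
- rewrite !nthE; case: eqVneq => // c'c c'_empty.
  case: eqVneq => [c''c [<-]|_]; last exact: after.
  by apply: c_min => //; rewrite -c''c.
Qed.

Lemma squeeze_set (row : spaced_row) c x :
  squeeze (set_nth None row c (Some x)) =
    squeeze (take c row) ++ x :: squeeze (drop c.+1 row).
Proof.
elim: row c => [|[y|] row IH] [|c] //=.
- by rewrite /ncons; elim: c.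
- by rewrite drop0.
- by congr cons; apply: IH.
- by rewrite drop0.
Qed.

Lemma squeeze_empty (row : spaced_row) c : nth None row c = None ->
  squeeze row = squeeze (take c row) ++ squeeze (drop c.+1 row).
Proof.
elim: row c => [|[y|] row IH] [|c] //=.
- by move=> /IH; rewrite /squeeze /= => ->.
- by rewrite drop0.
- exact: IH.
Qed.

Lemma squeeze_unset (up : seq cletter) c : (c < size up)%N ->
  squeeze (set_nth None (map Some up) c None) = take c up ++ drop c.+1 up.
Proof.
elim: up c => [|y up IH] [|c] //= cup.
  by rewrite drop0 /squeeze /=; elim: (up) => //= z s ->.
by rewrite /squeeze /=; congr cons; apply: IH.
Qed.

(** Since [up] increases, its largest movable entry is the rightmost one. *)
Lemma largest_movableP up low : sorted prism_lt up ->
  let row := inflation up low in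
  if largest_movable up low is Some c then
    [/\ (c < size up)%N, nth None row c = None
      & forall c', (c < c' < size up)%N -> nth None row c' != None]
  else forall c, (c < size up)%N -> nth None row c != None.
Proof.
move=> upS row; rewrite /largest_movable.
set s := movable up low.
have mem_s c : (c \in s) = (c < size up)%N && (nth None row c == None).
  by rewrite mem_filter mem_iota add0n andbC.
set t := [seq c <- s | _].
have mem_t c : c \in t = (c \in s) && all (fun c' => c' <= c)%N s.
  rewrite mem_filter andbC; have [cs|] //= := boolP (c \in s).
  apply: eq_in_all => c' c's.
  move: cs c's; rewrite !mem_s => /andP[cup _] /andP[c'up _].
  rewrite /prism_le; case: ltngtP => [c'c|cc'|->].
  - by rewrite (sorted_nth_prism _ upS) ?orbT ?c'c.
  - have lt := sorted_nth_prism (0, 0)%N upS (introT andP (conj cc' c'up)).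
    rewrite (negbTE (prism_lt_asym lt)) orbF; apply/eqP => E.
    by move: lt; rewrite E prism_lt_irr.
  - by rewrite eqxx.
case tE: t => [|c t'] /=.
  move=> c cup; apply/eqP => c_empty.
  have cs : c \in s by rewrite mem_s cup c_empty.
  have ub c' : c' \in s -> (c' <= size up)%N.
    by rewrite mem_s => /andP[/ltnW].
  case: (ex_maxnP (ex_intro (fun c => c \in s) c cs) ub) => m ms m_max.
  have : m \in t by rewrite mem_t ms; apply/allP => c' /m_max.
  by rewrite tE.
have : c \in t by rewrite tE mem_head.
rewrite mem_t mem_s => /andP[/andP[cup /eqP c_empty] /allP c_max].
split=> // c' /andP[cc' c'up]; apply/negP => c'_empty.
by have := c_max c'; rewrite mem_s c'up c'_empty leqNgt cc' => /(_ isT).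
Qed.

(** * Commutation with the raising operators *)

(** Entries in distinct columns have distinct partners below, so the hypothesis provides an
    injection; the induction removes one column at a time. *)
Lemma count_up_le (P Q : pred cletter) (up : seq cletter) (row : spaced_row) :
    (forall c u, onth up c = Some u -> P u ->
       exists2 e, nth None row c = Some e & Q e) ->
  (count P up <= count Q (squeeze row))%N.
Proof.
elim: up row => [|u up IH] [|o row] PQ //.
  rewrite leqn0 eqn0Ngt -has_count; apply/hasPn => v /onthP[c cv].
  by apply/negP => /(PQ c v cv)[e]; rewrite nth_nil.
rewrite /=.
have {IH} := IH row (fun c => PQ c.+1).
have := PQ 0%N u erefl; case: (P u) => [/(_ isT)[e /= -> /= ->]|_ le].
  by rewrite /= !add1n ltnS.
apply: leq_trans le _; rewrite /squeeze /=.
by case: o {PQ} => //= e; apply: leq_addl.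
Qed.

Lemma count_squeeze_le (P Q : pred cletter) (up : seq cletter)
    (row : spaced_row) :
    (forall c e, nth None row c = Some e -> Q e ->
       exists2 u, onth up c = Some u & P u) ->
  (count Q (squeeze row) <= count P up)%N.
Proof.
elim: row up => [|o row IH] up QP //=.
have {}IH : (count Q (squeeze row) <= count P (behead up))%N.
  by apply: IH => c e ce /(QP c.+1 e ce) [u]; case: (up) => //= *; exists u.
have := QP 0%N; case: o {QP} => [e|] /= QP; last first.
  by apply: leq_trans IH _; case: (up) => //= x s; apply: leq_addl.
rewrite /squeeze /=; have := QP e erefl; case: (Q e) => [/(_ isT)[u]|_].
  by case: (up) IH => //= x s IH [->] ->; apply: leq_add.
by apply: leq_trans IH _; case: (up) => //= x s; apply: leq_addl.
Qed.

Lemma onth_tnth (T : Type) n (t : n.-tuple T) (k : 'I_n) :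
  onth t k = Some (tnth t k).
Proof.
by rewrite onthE (nth_map (tnth_default t k)) ?size_tuple.
Qed.

(** The prefix counts in which [first_unmatched] is phrased become counts over rows, to which
    inflations apply. *)
Lemma count_c_map gamma n (b : word n) e d : sumn gamma = n ->
  count (fun x => index x (reading_cells gamma) < d)%N (tnth (c_map gamma b) e)
    = count_mem e (take d b).
Proof.
move=> gn; rewrite (permP (perm_c_map gamma b e)) count_map count_filter.
rewrite /word_filling.
have sz : size (reading_cells gamma) = size b.
  by rewrite size_reading_cells size_tuple.
have := reading_cells_uniq gamma.
move: (reading_cells gamma) (tval b) sz => s w {b gn}.
elim: s w d => [|x s IH] [|a w] //= d [sz] /andP[xs U].
rewrite eqxx; case: d => [|d].
  rewrite take0 /=; apply/eqP; rewrite eqn0Ngt -has_count -all_predC.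
  by apply/allP.
rewrite /= -(IH w d sz U); congr addn; apply: eq_in_count => -[y c] yc /=.
have ys : y \in s by have := map_f fst yc; rewrite [map _ _]unzip1_zip ?sz.
by rewrite ifN //; apply: contraNneq xs => ->.
Qed.

Lemma count_interval (T : Type) (f : T -> nat) s d m : (d <= m)%N ->
  (count (fun x => d <= f x < m) s + count (fun x => f x < d) s)%N
    = count (fun x => f x < m)%N s.
Proof. by move=> dm; elim: s => //= x s <-; lia. Qed.

(** Each required inequality compares the two letters in one factor of the word; it is proved by
    pairing the entries that share a column of the inflation. *)
Lemma first_unmatched_movable gamma n (b : word n) (i j : 'I_n) :
    sumn gamma = n -> i != j ->
  let H d := count_mem j (take d b) in
  let L d := count_mem i (take d b) in
  let up := tnth (c_map gamma b) j in
  let low := tnth (c_map gamma b) i in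
  if largest_movable up low is Some c then
    exists2 x, onth up c = Some x
      & first_unmatched H L n (index x (reading_cells gamma))
  else none_unmatched H L n.
Proof.
move=> gn ij H L up low; set pos := index^~ (reading_cells gamma).
have upS : sorted prism_lt up by apply: c_map_sorted.
have lowS : sorted prism_lt low by apply: c_map_sorted.
have posP e x : x \in tnth (c_map gamma b) e -> onth b (pos x) = Some e.
  by rewrite mem_c_map // => /eqP.
have pos_n e x : x \in tnth (c_map gamma b) e -> (pos x < n)%N.
  by move/posP => xe; rewrite -(size_tuple b) -onthTE xe.
have ltE e e' x y : x \in tnth (c_map gamma b) e ->
    y \in tnth (c_map gamma b) e' -> prism_lt x y = (pos y < pos x)%N.
  move=> /pos_n xn /pos_n yn; apply: prism_lt_index.
    by rewrite -index_mem size_reading_cells gn.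
  by rewrite -index_mem size_reading_cells gn.
have low_up : {in low, forall x, x \notin up}.
  move=> x /posP xi; apply/negP => /posP; rewrite xi => -[/eqP].
  by rewrite (negbTE ij).
have [rowE below after] := inflationP lowS low_up.
have mem_low c e : nth None (inflation up low) c = Some e -> e \in low.
  move=> ce; rewrite -rowE /squeeze mem_pmap map_id -ce mem_nth //.
  by rewrite ltnNge; apply/negP => /(nth_default None); rewrite ce.
have mem_up c u : onth up c = Some u -> u \in up.
  by move=> cu; apply/onthP; exists c.
have onth_up c : (c < size up)%N -> exists u, onth up c = Some u.
  by rewrite -onthTE; case: (onth up c) => // u; exists u.
have up_lt c c' u u' : onth up c = Some u -> onth up c' = Some u' ->
    (c < c')%N -> prism_lt u u'.
  move=> cu c'u' cc'; rewrite -(onth_nth u _ _ _ cu) -(onth_nth u _ _ _ c'u').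
  by rewrite sorted_nth_prism // cc' -onthTE c'u'.
have HE d : H d = count (fun x => pos x < d)%N up by rewrite count_c_map.
have LE d : L d = count (fun x => pos x < d)%N low by rewrite count_c_map.
have := largest_movableP low upS; case: largest_movable => [c|]; last first.
  (* Every entry of [up] has a smaller entry below it, which therefore occurs later in the word. *)
  move=> filled d dn; rewrite !HE !LE -!(count_interval pos _ dn).
  suff : (count (fun x => d <= pos x < n) up
            <= count (fun x => d <= pos x < n) low)%N by lia.
  rewrite -{1}rowE; apply: count_up_le => c u cu /andP[du _].
  case cE: (nth _ _ c) (filled c) => [e|]; last first.
    by rewrite -onthTE cu => /(_ isT).
  move=> _; exists e => //; have := below _ _ _ cE cu.
  rewrite (ltE i j) ?(mem_low _ _ cE) ?(mem_up _ _ cu) // => ue.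
  by rewrite (pos_n i) ?(mem_low _ _ cE) // andbT; lia.
case=> /onth_up[x cx] c_empty filled; exists x => //.
have xup := mem_up _ _ cx; have xn := pos_n _ _ xup.
split=> // d; rewrite -/(pos x).
  move=> dm; rewrite !HE !LE -!(count_interval pos _ dm).
  suff : (count (fun y => d <= pos y < pos x) up
            <= count (fun y => d <= pos y < pos x) low)%N by lia.
  rewrite -{1}rowE; apply: count_up_le => c' u c'u /andP[du ux].
  (* Letters before [x] in the word are larger than [x], hence stand right of column [c]. *)
  have cc' : (c < c')%N.
    rewrite ltnNge leq_eqVlt; apply/negP => /predU1P[c'c|].
      by move: c'u ux; rewrite c'c cx => -[->]; rewrite ltnn.
    move=> /(up_lt _ _ _ _ c'u cx); rewrite (ltE j j) ?(mem_up _ _ c'u) //.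
    by lia.
  case c'E: (nth _ _ c') (filled c') => [e|]; last first.
    by rewrite cc' -onthTE c'u => /(_ isT).
  move=> _; exists e => //; have := below _ _ _ c'E c'u.
  (* The entry [e] is below [u] and right of the empty cell under [x], so [x < e < u] and [e] lies
     in the same factor as [u]. *)
  have [x' + xe] := after _ _ _ cc' c_empty c'E.
  rewrite cx => -[xx']; move: xe; rewrite -xx'.
  rewrite (ltE j i x e) ?(ltE i j e u) ?(mem_low _ _ c'E) ?(mem_up _ _ c'u) //.
  by lia.
move=> /andP[md dn].
(* The letter at [x] itself gives the strictness; a weak inequality remains for the factor after
   it. *)
have tk : take (pos x).+1 b = rcons (take (pos x) b) j.
  rewrite (take_nth j) ?size_tuple // (onth_nth _ _ _ _ (posP _ _ xup)) //.
have HS : H (pos x).+1 = (H (pos x)).+1.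
  by rewrite /H tk -cats1 count_cat /= eqxx addn1.
have LS : L (pos x).+1 = L (pos x).
  by rewrite /L tk -cats1 count_cat /= [j == i]eq_sym (negbTE ij) !addn0.
suff : (L d + H (pos x).+1 <= H d + L (pos x).+1)%N by lia.
rewrite !HE !LE -!(count_interval pos _ md).
suff : (count (fun y => pos x < pos y < d) low
          <= count (fun y => pos x < pos y < d) up)%N by lia.
rewrite -{1}rowE; apply: count_squeeze_le => c' e c'e /andP[xe ed].
(* An entry right of the empty cell exceeds [x], so it would occur before [x] in the word. *)
have c'c : (c' < c)%N.
  case: (ltngtP c' c) => // [cc'|c'c].
    have [x' + xe'] := after _ _ _ cc' c_empty c'e.
    rewrite cx => -[xx']; move: xe'; rewrite -xx'.
    by rewrite (ltE j i) ?(mem_low _ _ c'e) //; lia.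
  by move: c'e; rewrite c'c c_empty.
have [u c'u] : exists u, onth up c' = Some u.
  by apply: onth_up; apply: ltn_trans c'c _; rewrite -onthTE cx.
(* From [e < u < x], the entry [u] lies in the same factor as [e]. *)
exists u => //; have := below _ _ _ c'e c'u; have := up_lt _ _ _ _ c'u cx c'c.
by rewrite (ltE j j u x) ?(ltE i j e u) ?(mem_low _ _ c'e) ?(mem_up _ _ c'u) //; lia.
Qed.

(** Entries left of [c] lie under entries of [up] smaller than [x]; those right of [c] exceed [x]
    because cell [c] is empty. *)
Lemma sorted_move_down up low c x :
    sorted prism_lt low -> inflated up low (inflation up low) ->
    nth None (inflation up low) c = None -> onth up c = Some x ->
    sorted prism_lt up ->
  sorted prism_lt
    (squeeze (set_nth None (inflation up low) c (Some x))).
Proof.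
move=> lowS [rowE below after] c_empty cx upS; rewrite squeeze_set.
move: lowS; rewrite -{1}rowE (squeeze_empty c_empty).
rewrite !(sorted_pairwise prism_lt_trans) !pairwise_cat.
case/and3P => LR Lp Rp; rewrite pairwise_cons Lp Rp allrel_consr LR !andbT /=.
have mem_squeeze r y : y \in squeeze r -> exists k, nth None r k = Some y.
  rewrite mem_pmap map_id => /(nthP None)[k _ kE]; by exists k.
apply/andP; split; apply/allP => y /mem_squeeze[k].
  have [kc|ck] := ltnP k c; last first.
    by rewrite nth_default // (leq_trans _ ck) // size_take_min geq_minl.
  rewrite nth_take // => ky.
  have [u ku] : exists u, onth up k = Some u.
    have : (k < size up)%N by apply: ltn_trans kc _; rewrite -onthTE cx.
    by rewrite -onthTE; case: (onth up k) => // u; exists u.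
  apply: prism_lt_trans (below _ _ _ ky ku) _.
  rewrite -(onth_nth u _ _ _ ku) -(onth_nth u _ _ _ cx).
  by rewrite sorted_nth_prism // kc -onthTE cx.
rewrite nth_drop => ky.
have [|u] := after c _ _ _ c_empty ky; first by rewrite addSn ltnS leq_addr.
by rewrite cx => -[->].
Qed.

(** By uniqueness of the leftmost unmatched parenthesis, both operators move the same letter [x]
    from row [j] to row [i]. As rows are sorted, it remains to compare them as sets. *)
Lemma c_map_e_tilde gamma n (i j : 'I_n) (b : word n) :
    sumn gamma = n -> i != j ->
  omap (@c_map gamma n) (e_tilde i j b) = e_dagger i j (c_map gamma b).
Proof.
move=> gn ij; rewrite /e_dagger.
set up := tnth _ j; set low := tnth _ i.
have upS : sorted prism_lt up by apply: c_map_sorted.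
have lowS : sorted prism_lt low by apply: c_map_sorted.
have low_up : {in low, forall x, x \notin up}.
  move=> x; rewrite !mem_c_map // => /eqP->; apply/negP => /eqP[/eqP].
  by rewrite (negbTE ij).
have infl := inflationP lowS low_up.
have := first_unmatched_movable b gn ij; rewrite /= -/up -/low.
have := e_tildeP b ij; have := largest_movableP low upS.
case: e_tilde => [b'|]; case: largest_movable => [c|] //=; first last.
(* The two operators vanish together. *)
- by move=> _ none [x _ /(none_first_unmatched none)].
- by move=> _ [m [first _ _]] none; case: (none_first_unmatched none first).
move=> [cup c_empty _] [m [first bm b'E]] [x cx first'].
have mx := first_unmatched_uniq first first'.
have cells_x : x \in reading_cells gamma.
  by rewrite -index_mem -mx size_reading_cells gn.
have xupE : up = take c up ++ x :: drop c.+1 up.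
  by rewrite -{1}(cat_take_drop c up) (drop_nth x) // (onth_nth x _ _ _ cx).
have mem_row l y (w : word n) (k : 'I_n) :
    index y (reading_cells gamma) = k ->
    (y \in tnth (c_map gamma w) l) = (tnth w k == l).
  by move=> yk; rewrite mem_c_map // yk onth_tnth.
(* A letter that is not a cell has index [n], past the end of the word. *)
have not_row l y (w : word n) : y \notin reading_cells gamma ->
    (y \in tnth (c_map gamma w) l) = false.
  move=> ycells; rewrite mem_c_map // onth_default //.
  by rewrite (memNindex ycells) size_reading_cells gn size_tuple.
have pos_ord y : y \in reading_cells gamma ->
    exists k : 'I_n, index y (reading_cells gamma) = k.
  by rewrite -index_mem size_reading_cells gn => yn; exists (Ordinal yn).
have eqxE y (k : 'I_n) : index y (reading_cells gamma) = k ->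
    (k == m) = (y == x).
  move=> yk; apply/eqP/eqP => [km|yx]; last first.
    by apply: val_inj; rewrite /= mx -yx yk.
  have ycells : y \in reading_cells gamma.
    by rewrite -index_mem yk size_reading_cells gn.
  by rewrite -(nth_index x ycells) yk km mx nth_index.
congr Some; apply: eq_from_tnth => l; rewrite [RHS]tnth_mktuple.
apply: prism_sorted_eq; first exact: c_map_sorted.
  case: ifP => _; first by rewrite cx; apply: sorted_move_down.
  case: ifP => _; last exact: c_map_sorted.
  rewrite squeeze_unset //; move: upS; rewrite {1}xupE.
  apply: (subseq_sorted prism_lt_trans).
  by rewrite cat_subseq // subseq_cons.
move=> y; have [ycells|ycells] := boolP (y \in reading_cells gamma); last first.
  rewrite not_row //; apply/esym.
  case: ifP => _; last case: ifP => _; last exact: not_row.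
    rewrite cx squeeze_set; apply: contraNF ycells.
    rewrite mem_cat inE orbCA -mem_cat -squeeze_empty //.
    have [->|_] //= := eqVneq y x; case: infl => [-> _ _].
    by apply: contraTT => /not_row->.
  rewrite squeeze_unset //; apply/negbTE; apply: contraNN ycells => y_up.
  have : y \in up by rewrite xupE mem_cat inE orbCA -mem_cat y_up orbT.
  by apply: contraTT => /not_row->.
have [k yk] := pos_ord y ycells; rewrite (mem_row _ _ _ _ yk) b'E (eqxE _ _ yk).
have [->|li] := eqVneq l i.
  rewrite cx squeeze_set mem_cat inE orbCA -mem_cat -squeeze_empty //.
  case: infl => [-> _ _]; rewrite (mem_row _ _ _ _ yk).
  by case: (y == x); rewrite ?eqxx.
have [->|lj] := eqVneq l j.
  rewrite squeeze_unset //.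
  have : y \in up = (tnth b k == j) by apply: mem_row.
  have : uniq up by apply: (sorted_uniq prism_lt_trans prism_lt_irr).
  rewrite {1 2}xupE cat_uniq /= !(mem_cat, inE) negb_or.
  case: (eqVneq y x) => [->|yx] //= /and4P[_ /andP[xt _] xd _] _.
  by rewrite (negbTE ij) (negbTE xt) (negbTE xd).
rewrite (mem_row _ _ _ _ yk) -(eqxE _ _ yk).
have [->|_] := eqVneq k m; last by [].
rewrite bm.
by rewrite ![_ == l]eq_sym (negbTE li) (negbTE lj).
Qed.

(** * Bijectivity, weights and highest weight elements *)

Lemma count_flatten_tuple (A : Type) n (P : pred A) (T : n.-tuple (seq A)) :
  count P (flatten T) = \sum_(e < n) count P (tnth T e).
Proof. by rewrite count_flatten sumnE big_map big_tuple. Qed.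

Lemma flatten_c_map gamma n (b : word n) : sumn gamma = n ->
  perm_eq (flatten (c_map gamma b)) (reading_cells gamma).
Proof.
move=> gn; apply/permP => P; rewrite count_flatten_tuple.
have sz : size (reading_cells gamma) = size b.
  by rewrite size_reading_cells size_tuple gn.
rewrite -[in RHS](unzip1_zip (eq_leq sz)) count_map -/(word_filling gamma b).
under eq_bigr => e _.
  rewrite (permP (perm_c_map gamma b e)) count_map count_filter; over.
elim: (word_filling gamma b) => [|[x a] s IH] /=; first by rewrite big1.
rewrite big_split /= IH; congr addn.
rewrite (bigD1 a) //= eqxx andbT big1 ?addn0 // => e /negbTE ea.
by rewrite eq_sym ea andbF.
Qed.

Lemma CTany_c_map gamma n (b : word n) : sumn gamma = n ->
  CTany gamma (c_map gamma b).
Proof.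
move=> gn; have perm := flatten_c_map b gn; exists (fshape (c_map gamma b)).
split; last by split=> // r; apply: c_map_sorted.
by rewrite -[RHS]gn -(size_reading_cells gamma) -(perm_size perm) size_flatten.
Qed.

Lemma mem_c_map_nth gamma n (b : word n) x0 (k : 'I_n) e : sumn gamma = n ->
  (nth x0 (reading_cells gamma) k \in tnth (c_map gamma b) e) = (tnth b k == e).
Proof.
move=> gn; rewrite mem_c_map // index_uniq ?reading_cells_uniq //.
  by rewrite onth_tnth.
by rewrite size_reading_cells gn.
Qed.

Lemma c_map_inj gamma n : sumn gamma = n -> injective (@c_map gamma n).
Proof.
move=> gn b b' E; apply: eq_from_tnth => k.
have := mem_c_map_nth b (0, 0)%N k (tnth b k) gn.
by rewrite E mem_c_map_nth // eqxx => /eqP->.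
Qed.

Lemma CTany_disjoint gamma n (T : filling n) (i j : 'I_n) x :
  CTany gamma T -> x \in tnth T i -> x \in tnth T j -> i = j.
Proof.
case=> delta [_ [_ perm _]] xi xj; apply/eqP; apply: contraTT isT => ij.
have : (count_mem x (flatten T) <= 1)%N.
  by rewrite (permP perm) count_uniq_mem ?reading_cells_uniq // leq_b1.
rewrite count_flatten_tuple (bigD1 i) //= (bigD1 j) 1?eq_sym //=.
move: xi xj; rewrite -!has_pred1 !has_count.
by case: (count _ _) => // p _; case: (count _ _) => // q _; rewrite addSn addnS.
Qed.

Lemma c_map_surj gamma n (T : filling n) : sumn gamma = n ->
  CTany gamma T -> exists b : word n, c_map gamma b = T.
Proof.
move=> gn CT_T; have [delta [_ [_ perm sortedT]]] := CT_T.
pose x (k : 'I_n) := nth (0, 0)%N (reading_cells gamma) k.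
(* The letter at position [k] is the row of [T] holding the cell number [k]; the default is never
   reached, since every cell occurs in [T]. *)
exists [tuple odflt k [pick e | x k \in tnth T e] | k < n].
set b : word n := mktuple _.
have bP k : x k \in tnth T (tnth b k).
  rewrite tnth_mktuple; case: pickP => //= none.
  have : x k \in flatten T.
    by rewrite (perm_mem perm) mem_nth // size_reading_cells gn.
  by case/flattenP => s /tnthP[e ->] xe; have := none e; rewrite xe.
apply: eq_from_tnth => e; apply: prism_sorted_eq => // [|y].
  exact: c_map_sorted.
have [ycells|ycells] := boolP (y \in reading_cells gamma).
  have := ycells; rewrite -index_mem size_reading_cells gn => kn.
  rewrite -(nth_index (0, 0)%N ycells) (mem_c_map_nth b _ (Ordinal kn)) //.
  by apply/eqP/idP => [<-|]; [|apply: CTany_disjoint CT_T _]; apply: bP.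
transitivity false.
  apply: contraNF ycells => ye; rewrite -(perm_mem (flatten_c_map b gn)).
  by apply/flattenP; exists (tnth (c_map gamma b) e); rewrite ?mem_tnth.
apply/esym; apply: contraNF ycells => ye; rewrite -(perm_mem perm).
by apply/flattenP; exists (tnth T e); rewrite ?mem_tnth.
Qed.

Lemma wt_c_map gamma n (b : word n) : sumn gamma = n ->
  wt_CT (c_map gamma b) = wt_word b.
Proof.
move=> gn; rewrite /wt_CT /xpow mpolyXE_id /wt_word.
rewrite [RHS](partition_big (tnth b) predT) //=; apply: eq_bigr => e _.
rewrite (eq_bigr (fun=> 'X_e)%R); last by move=> k /eqP->.
rewrite GRing.prodr_const multinomE tnth_map; congr (_ ^+ _)%R.
have := count_c_map b e n gn; rewrite take_oversize ?size_tuple //.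
have -> : count_mem e b = #|[pred k | tnth b k == e]|.
  by rewrite -sum1_count big_tuple sum1_card.
move=> <-; apply/esym/eqP; rewrite -all_count; apply/allP => y.
rewrite mem_c_map // => /eqP yb; rewrite -[X in (_ < X)%N](size_tuple b).
by rewrite -onthTE yb.
Qed.

Lemma onth_squeeze (row : spaced_row) c :
    (forall c', (c' <= c)%N -> nth None row c' != None) ->
  onth (squeeze row) c = nth None row c.
Proof.
elim: row c => [|[x|] row IH] c filled; first by rewrite onth0n nth_nil.
  by case: c filled => [|c] filled //=; apply: IH => c'; apply: (filled c'.+1).
by have := filled 0%N isT.
Qed.

(** If all cells under [up] are filled, left-justifying does not move them, so [low] inherits the
    inequalities of the inflation. Conversely, an empty cell breaks strictness in its own column. *)
Lemma largest_movable_None up low :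
    sorted prism_lt low -> sorted prism_lt up ->
    {in low, forall x, x \notin up} -> (size up <= size low)%N ->
  largest_movable up low = None <->
    (forall c x y, onth low c = Some x -> onth up c = Some y -> prism_lt x y).
Proof.
move=> lowS upS low_up sz; have [rowE below after] := inflationP lowS low_up.
have := largest_movableP low upS; case: largest_movable => [c|] /=.
  case=> cup c_empty _; split=> // strict.
  have : onth low c by rewrite onthTE (leq_trans cup).
  case lowc: (onth low c) => [x|] // _.
  have : onth up c by rewrite onthTE.
  case upc: (onth up c) => [y|] // _.
  have xy := strict _ _ _ lowc upc.
  (* The first [c] cells of the inflation hold at most [c] entries, so [x] comes from the right of
     the empty cell and exceeds the entry [y] above that cell. *)
  move: lowc; rewrite -rowE (squeeze_empty c_empty) onth_cat ifN; last first.
    rewrite -leqNgt size_pmap (leq_trans (count_size _ _)) //.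
    by rewrite size_take_min geq_minl.
  set k := (_ - _)%N => xk.
  have : x \in squeeze (drop c.+1 (inflation up low)).
    by apply/onthP; exists k.
  rewrite mem_pmap map_id => /(nthP None)[k' _]; rewrite nth_drop => k'x.
  have [|y'] := after c _ _ _ c_empty k'x; first by rewrite addSn ltnS leq_addr.
  by rewrite upc => -[<-]; rewrite (negbTE (prism_lt_asym xy)).
move=> filled; split=> // _ c x y; rewrite -{1}rowE => xc yc.
have cup : (c < size up)%N by rewrite -onthTE yc.
apply: below yc; rewrite -xc onth_squeeze // => c' c'c.
by apply: filled; apply: leq_ltn_trans cup.
Qed.

Lemma e_dagger_None n (i j : 'I_n) (T : filling n) :
  e_dagger i j T = None <-> largest_movable (tnth T j) (tnth T i) = None.
Proof. by rewrite /e_dagger; case: largest_movable. Qed.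

Lemma CTany_highest_weight gamma n (mu : n.-tuple nat) (T : filling n) :
    sorted geq mu -> CTany gamma T -> fshape T = mu ->
  highest_weight T <-> column_strict T.
Proof.
move=> muS CT_T shT; have [delta [_ [_ _ sortedT]]] := CT_T.
have size_T r : size (tnth T r) = nth 0%N mu r.
  by rewrite -shT -tnth_nth tnth_map.
have size_le (r r' : 'I_n) : (r <= r')%N ->
    (size (tnth T r') <= size (tnth T r))%N.
  move=> rr'; rewrite !size_T; apply: (@sorted_leq_nth _ geq) => //.
  - by move=> x y z /= xy yz; apply: leq_trans yz xy.
  - by move=> x /=.
  - by rewrite inE size_tuple.
  - by rewrite inE size_tuple.
have adjacent (i j : 'I_n) : j = i.+1 :> nat -> e_dagger i j T = None <->
    (forall c x y, onth (tnth T i) c = Some x -> onth (tnth T j) c = Some y ->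
      prism_lt x y).
  move=> ji; apply: iff_trans (e_dagger_None i j T) _.
  apply: largest_movable_None => //; last by rewrite size_le // ji.
  move=> x xi; apply/negP => xj; have ij := CTany_disjoint CT_T xi xj.
  by move: ji; rewrite ij => /eqP; rewrite ltn_eqF.
split=> [hw r r' c x y rr'|strict i j ji]; last first.
  by apply/(adjacent i j ji) => c x y; apply: strict; rewrite ji.
(* The operators only compare adjacent rows; distant rows follow by transitivity, by induction on
   their distance. *)
have [d rE] : exists d, r' = (r + d).+1 :> nat by exists (r' - r.+1)%N; lia.
elim: d r' rE rr' y => [|d IH] r' rE rr' y xc yc.
  by rewrite addn0 in rE; apply: (proj1 (adjacent r r' rE) (hw _ _ rE)) xc yc.
have r1n : ((r + d).+1 < n)%N by have := ltn_ord r'; lia.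
pose r1 := Ordinal r1n.
have r1r' : r' = r1.+1 :> nat by rewrite rE addnS.
(* As the shape is a partition, the intermediate row also has a cell in column [c]. *)
have : onth (tnth T r1) c.
  rewrite onthTE (leq_trans _ (size_le r1 r' _)) ?r1r' //.
  by rewrite -onthTE yc.
case zc: (onth (tnth T r1) c) => [z|] // _.
apply: (@prism_lt_trans z); first by apply: (IH r1) => //=; lia.
exact: (proj1 (adjacent r1 r' r1r') (hw _ _ r1r')) zc yc.
Qed.

Theorem theorem37 (n : nat) (gamma : seq nat) (hgamma : sumn gamma = n) :
  [/\ (* c_gamma is a bijection from B(1)^n onto CT(., gamma) *)
      [/\ forall b : word n, CTany gamma (c_map gamma b),
          injective (@c_map gamma n)
        & forall T : filling n, CTany gamma T ->
            exists b : word n, c_map gamma b = T],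
      (* c_gamma preserves weights *)
      forall b : word n, wt_CT (c_map gamma b) = wt_word b,
      (* c_gamma commutes with the raising operators *)
      forall (i j : 'I_n) (b : word n), j = i.+1 :> nat ->
        omap (@c_map gamma n) (e_tilde i j b) = e_dagger i j (c_map gamma b)
    & (* highest weight elements of weight mu *)
      forall mu : n.-tuple nat, sorted geq mu -> sumn mu = n ->
        forall T : filling n,
          [/\ CTany gamma T, highest_weight T & wt_CT T = xpow mu] <->
          CT mu gamma T /\ column_strict T].
Proof.
split.
- split; [by move=> b; apply: CTany_c_map | exact: c_map_inj |].
  by move=> T; apply: c_map_surj.
- by move=> b; apply: wt_c_map.
- move=> i j b ji; apply: c_map_e_tilde => //.
  by apply/eqP => ij; move: ji; rewrite ij => /eqP; rewrite ltn_eqF.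
move=> mu muS mun T; split=> [[CT_T hw wtT]|[CT_T strict]].
  have shT : fshape T = mu.
    apply: eq_from_tnth => r.
    (* Taking the coefficient at the monomial of [mu] recovers the shape from the weight. *)
    have /(congr1 (mcoeff [multinom mu])) := wtT.
    rewrite /wt_CT /xpow !mcoeffX eqxx; case: eqP => // E _.
    by have := congr1 (fun m : 'X_{1..n} => m r) E; rewrite !multinomE.
  split; last by apply/(CTany_highest_weight muS CT_T shT).
  by have [delta [_ [_ perm sortedT]]] := CT_T; split.
have CTany_T : CTany gamma T by exists mu.
have [shT _ _] := CT_T; split=> //; last by rewrite /wt_CT shT.
by apply/(CTany_highest_weight muS CTany_T shT).
Qed.
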